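(* Let $\Gamma$ be a finite group, let $\Gamma_1$ be a normal subgroup of $\Gamma$, let $n\ge 4$, and let $M$ be an elementary lift of the frame matroid $F(K_n^{\Gamma},\psi_n^{\Gamma}/\Gamma_1)$ such that a cycle of $K_n^\Gamma$ is a circuit of $M$ if and only if it is $\psi_n^\Gamma$-balanced. Then there is a collection $\mathcal A$ of subgroups of $\Gamma$ such that $\{\Gamma_1\}\cup\mathcal A$ is a partition of $\Gamma$, each $A\in\mathcal A$ is malnormal and every conjugate of every $A\in\mathcal A$ is in $\mathcal A$, and $M=M(\Gamma,\Gamma_1,\mathcal A,K_n^\Gamma,\psi_n^\Gamma)$.
   Context: $K_n^\Gamma$ is the graph with vertices $v_1,\dots,v_n$ and, for each $1\le i<j\le n$ and each $\alpha\in\Gamma$, an edge $\alpha_{ij}$ with ends $v_i,v_j$; $\psi_n^\Gamma$ is the $\Gamma$-gain function with $\psi_n^\Gamma(\alpha_{ij},v_i,v_j)=\alpha$ (and $\psi_n^\Gamma(\alpha_{ij},v_j,v_i)=\alpha^{-1}$). General conventions: an oriented edge is a triple $(e,u,v)$ with $e$ an edge with ends $u,v$; a $\Gamma$-gain function $\psi$ assigns to oriented edges elements of $\Gamma$ with $\psi(e,u,v)=\psi(e,v,u)^{-1}$ for $u\neq v$. For a walk $W=v_1,e_1,\dots,e_k,v_{k+1}$, $\psi(W)=\prod_i\psi(e_i,v_i,v_{i+1})$. A cycle is $\psi$-balanced if a simple closed walk $W$ around it has $\psi(W)$ equal to the identity $\varepsilon$. $\psi(e)$ is the set of values of the orientations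 of $e$ and $\psi(X)=\bigcup_{e\in X}\psi(e)$. For $\eta:V(G)\to\Gamma$, $\psi^\eta(e,u,v)=\eta(u)^{-1}\psi(e,u,v)\eta(v)$. $\psi/\Gamma_1$ is $\psi$ composed with the quotient map $\Gamma\to\Gamma/\Gamma_1$. $G[X]$ is the subgraph formed by the edges in $X$ and their ends. A partition of $\Gamma$ is a collection of subgroups such that every non-identity element lies in exactly one of them; $A$ is malnormal if $\gamma^{-1}A\gamma\cap A=\{\varepsilon\}$ for all $\gamma\notin A$. Frame matroid: for a gain graph $(G,\varphi)$, $F(G,\varphi)$ is the matroid on $E(G)$ whose circuits are the $\varphi$-balanced cycles, tight handcuffs (two edge-disjoint cycles sharing exactly one vertex) and loose handcuffs (two vertex-disjoint cycles joined by a minimal path) with both cycles unbalanced, and theta graphs (three internally disjoint paths between two distinct vertices) with all three cycles unbalanced. An elementary lift of a matroid $N$ is a matroid $M$ with $K\setminus e=M$, $K/e=N$ for some matroid $K$ and element $e$. Construction: for a group $\Gamma$, normal subgroup $\Gamma_1$, a collection $\mathcal A$ as in the claim, and a $\Gamma$-gain graph $(G,\psi)$, let $N=F(G,\psi/\Gamma_1)$ and let $\mathcal C(\Gamma,\Gamma_1,\mathcal A,G,\psi)$ be the set of circuits $C$ of $N$ that are $\psi$-balanced cycles, or are handcuffs or theta graphs for which there are a switching function $\eta$ and $A\in\mathcal A$ with $\psi^\eta(C)\subseteq A$. Then $M(\Gamma,\Gamma_1,\mathcal A,G,\psi)$ is the matroid on $E(G)$ with rank function $r(X)=r_N(X)$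 if every circuit of $N|X$ lies in $\mathcal C(\Gamma,\Gamma_1,\mathcal A,G,\psi)$ and $r(X)=r_N(X)+1$ otherwise (this is a matroid and an elementary lift of $N$). *)

(* Defs.v *)
From HB Require Import structures.
From mathcomp Require Import all_boot all_fingroup.

Set Implicit Arguments.
Unset Strict Implicit.
Unset Printing Implicit Defensive.

Record matroid (E : finType) := Matroid {
  rank : {set E} -> nat;
  rank_card : forall X : {set E}, rank X <= #|X|;
  rank_mono : forall X Y : {set E}, X \subset Y -> rank X <= rank Y;
  rank_submod : forall X Y : {set E},
    rank (X :|: Y) + rank (X :&: Y) <= rank X + rank Y }.

Section Matroids.
Variable E : finType.

Definition circuit (M : matroid E) (C : {set E}) : Prop :=
  minset (fun X : {set E} => rank M X < #|X|) C.

(* Deletion and contraction of the element [None] of a matroid on [option E],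
   which is how "E together with one new element e" is encoded. *)
Section Minors.
Variable K : matroid (option E).

Definition del_rank (X : {set E}) : nat := rank K (Some @: X).
Definition contr_rank (X : {set E}) : nat :=
  rank K (None |: Some @: X) - rank K [set None].

Lemma del_rank_card (X : {set E}) : del_rank X <= #|X|.
Proof. by apply: leq_trans (rank_card K _) _; apply: leq_imset_card. Qed.

Lemma del_rank_mono (X Y : {set E}) : X \subset Y -> del_rank X <= del_rank Y.
Proof. by move=> sXY; apply: rank_mono; apply: imsetS. Qed.

Lemma imset_SomeI (X Y : {set E}) :
  Some @: (X :&: Y) = (Some @: X) :&: (Some @: Y).
Proof. by apply: imsetI => x y _ _ []. Qed.

Lemma del_rank_submod (X Y : {set E}) :
  del_rank (X :|: Y) + del_rank (X :&: Y) <= del_rank X + del_rank Y.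
Proof. by rewrite /del_rank imsetU imset_SomeI rank_submod. Qed.

Lemma rank_None_le (X : {set option E}) : rank K [set None] <= rank K (None |: X).
Proof. by apply: rank_mono; apply: subsetUl. Qed.

Lemma contr_rank_card (X : {set E}) : contr_rank X <= #|X|.
Proof.
rewrite leq_subLR; apply: (@leq_trans (rank K [set None] + rank K (Some @: X))).
  by apply: leq_trans (rank_submod K _ _); apply: leq_addr.
by rewrite leq_add2l del_rank_card.
Qed.

Lemma contr_rank_mono (X Y : {set E}) : X \subset Y -> contr_rank X <= contr_rank Y.
Proof.
by move=> sXY; apply: leq_sub2r; apply: rank_mono; apply: setUS; apply: imsetS.
Qed.

Lemma contr_rank_submod (X Y : {set E}) :
  contr_rank (X :|: Y) + contr_rank (X :&: Y) <= contr_rank X + contr_rank Y.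
Proof.
rewrite -(leq_add2r (rank K [set None] + rank K [set None])).
rewrite /contr_rank addnACA [leqRHS]addnACA !subnK ?rank_None_le //.
by rewrite imsetU imset_SomeI setUUr setUIr rank_submod.
Qed.

Definition deletion : matroid E :=
  Matroid del_rank_card del_rank_mono del_rank_submod.
Definition contraction : matroid E :=
  Matroid contr_rank_card contr_rank_mono contr_rank_submod.
End Minors.

Definition elementary_lift (M N : matroid E) : Prop :=
  exists K : matroid (option E),
    rank (deletion K) =1 rank M /\ rank (contraction K) =1 rank N.

End Matroids.

(* The order of the two ends in [ends e] carries no meaning. *)
Record mgraph := MGraph {
  vert : finType;
  edge : finType;
  ends : edge -> vert * vert }.

Section Graphs.
Variable G : mgraph.
Local Notation V := (vert G).
Local Notation E := (edge G).

(* [joins e u v]: the triple (e, u, v) is an oriented edge. *)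
Definition joins (e : E) (u v : V) : bool :=
  (ends e == (u, v)) || (ends e == (v, u)).

Definition verts (X : {set E}) : {set V} :=
  [set v | [exists e in X, exists u, joins e u v]].

(* The walk x, e_1, y_1, ..., e_k, y_k is given by its initial vertex x and the
   sequence (e_1, y_1), ..., (e_k, y_k). *)
Fixpoint is_walk (x : V) (p : seq (E * V)) : bool :=
  if p is (e, y) :: p' then joins e x y && is_walk y p' else true.

Definition walk_end (x : V) (p : seq (E * V)) : V := last x (unzip2 p).
Definition walk_verts (x : V) (p : seq (E * V)) : {set V} :=
  [set v in x :: unzip2 p].
Definition walk_edges (p : seq (E * V)) : {set E} := [set e in unzip1 p].

(* Distinctness of the edges only matters for closed walks of length 2. *)
Definition simple_closed_walk (x : V) (p : seq (E * V)) : bool :=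
  [&& is_walk x p, p != [::], walk_end x p == x,
      uniq (unzip2 p) & uniq (unzip1 p)].

Definition is_path (x y : V) (p : seq (E * V)) : bool :=
  [&& is_walk x p, walk_end x p == y & uniq (x :: unzip2 p)].

(* Cycles, handcuffs and thetas are identified with their edge sets. *)
Definition is_cycle (C : {set E}) : Prop :=
  exists x p, simple_closed_walk x p /\ C = walk_edges p.

Definition tight_handcuff (C1 C2 X : {set E}) : Prop :=
  [/\ is_cycle C1, is_cycle C2, [disjoint C1 & C2],
      #|verts C1 :&: verts C2| = 1 & X = C1 :|: C2].

Definition loose_handcuff (C1 C2 X : {set E}) : Prop :=
  [/\ is_cycle C1, is_cycle C2, [disjoint verts C1 & verts C2] &
      exists x y p,
        [/\ is_path x y p,
            walk_verts x p :&: verts C1 = [set x],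
            walk_verts x p :&: verts C2 = [set y] &
            X = C1 :|: C2 :|: walk_edges p]].

Definition handcuff (C1 C2 X : {set E}) : Prop :=
  tight_handcuff C1 C2 X \/ loose_handcuff C1 C2 X.

Definition internally_disjoint (u v : V) (p q : seq (E * V)) : Prop :=
  walk_verts u p :&: walk_verts u q = [set u; v] /\
  [disjoint walk_edges p & walk_edges q].

(* [P1], [P2], [P3] are the edge sets of the three paths of the theta [X]. *)
Definition theta (P1 P2 P3 X : {set E}) : Prop :=
  exists u v p1 p2 p3,
    [/\ u != v,
        [/\ is_path u v p1, is_path u v p2 & is_path u v p3],
        [/\ internally_disjoint u v p1 p2, internally_disjoint u v p1 p3
          & internally_disjoint u v p2 p3],
        [/\ P1 = walk_edges p1, P2 = walk_edges p2 & P3 = walk_edges p3] &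
        X = P1 :|: P2 :|: P3].

End Graphs.

Local Open Scope group_scope.

(* [gain psi e u v] is meaningful only when [joins e u v]. *)
Record gain_fun (gT : finGroupType) (G : mgraph) := GainFun {
  gain :> edge G -> vert G -> vert G -> gT;
  gainV : forall e u v, joins e u v -> u != v ->
    gain e u v = (gain e v u)^-1 }.

Section Gains.
Variables (gT : finGroupType) (G : mgraph).
Implicit Type psi : gain_fun gT G.

Fixpoint walk_gain psi (x : vert G) (p : seq (edge G * vert G)) : gT :=
  if p is (e, y) :: p' then psi e x y * walk_gain psi y p' else 1.

Definition balanced psi (C : {set edge G}) : Prop :=
  exists x p,
    [/\ simple_closed_walk x p, C = walk_edges p & walk_gain psi x p = 1].

Definition gain_set psi (X : {set edge G}) : {set gT} :=
  [set a | [exists e in X, exists u, exists v,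
              joins e u v && (a == psi e u v)]].

Lemma switch_gainV psi (eta : vert G -> gT) e u v : joins e u v -> u != v ->
  (eta u)^-1 * psi e u v * eta v = ((eta v)^-1 * psi e v u * eta u)^-1.
Proof. by move=> euv uv; rewrite !invMg invgK -(gainV _ euv uv) mulgA. Qed.

Definition switch psi (eta : vert G -> gT) : gain_fun gT G :=
  GainFun (switch_gainV psi eta).

Lemma coset_invg (H : {group gT}) x : coset H x^-1 = (coset H x)^-1.
Proof.
have [Nx|Nx] := boolP (x \in 'N(H)); first by rewrite morphV.
by rewrite !coset_default ?groupV ?invg1 // (negPf Nx).
Qed.

Lemma quo_gainV (H : {group gT}) psi e u v : joins e u v -> u != v ->
  coset H (psi e u v) = (coset H (psi e v u))^-1.
Proof. by move=> euv uv; rewrite (gainV _ euv uv) coset_invg. Qed.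

Definition quo_gain (H : {group gT}) psi : gain_fun (coset_of H) G :=
  GainFun (quo_gainV H psi).

Definition frame_circuit psi (C : {set edge G}) : Prop :=
  [\/ balanced psi C,
      exists C1 C2,
        [/\ handcuff C1 C2 C, ~ balanced psi C1 & ~ balanced psi C2] |
      exists P1 P2 P3,
        [/\ theta P1 P2 P3 C, ~ balanced psi (P1 :|: P2),
            ~ balanced psi (P1 :|: P3) & ~ balanced psi (P2 :|: P3)]].

(* A matroid is determined by its circuits, so this says N = F(G, psi). *)
Definition is_frame_matroid psi (N : matroid (edge G)) : Prop :=
  forall C, circuit N C <-> frame_circuit psi C.

End Gains.

Section Construction.
Variables (gT : finGroupType) (G1 : {group gT}) (A : {set {group gT}}).
Variables (G : mgraph) (psi : gain_fun gT G).

Definition lift_circuit (N : matroid (edge G)) (C : {set edge G}) : Prop :=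
  circuit N C /\
  (balanced psi C \/
   ((exists C1 C2, handcuff C1 C2 C) \/ (exists P1 P2 P3, theta P1 P2 P3 C)) /\
   (exists eta : vert G -> gT, exists2 B : {group gT},
      B \in A & gain_set (switch psi eta) C \subset B)).

Definition is_gain_lift (M : matroid (edge G)) : Prop :=
  exists2 N : matroid (edge G), is_frame_matroid (quo_gain G1 psi) N &
    forall X : {set edge G},
      let all_lift := forall C, circuit N C -> C \subset X -> lift_circuit N C in
      (all_lift -> rank M X = rank N X) /\
      (~ all_lift -> rank M X = (rank N X).+1).

End Construction.

Definition subgroup_partition (gT : finGroupType) (P : {set {group gT}}) : Prop :=
  forall x : gT, x != 1 -> exists! H : {group gT}, H \in P /\ x \in H.

Definition malnormal (gT : finGroupType) (B : {group gT}) : Prop :=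
  forall g : gT, g \notin B -> B :^ g :&: B = [set 1].

Section CompleteGainGraph.
Variables (gT : finGroupType) (n : nat).

(* The edge alpha_ij is the triple (i, j, alpha) with i < j. *)
Definition Kedge := {t : 'I_n * 'I_n * gT | (t.1.1 < t.1.2)%N}.

Definition Kgraph : mgraph :=
  @MGraph 'I_n Kedge (fun e : Kedge => (val e).1).

Definition Kgain_val (e : edge Kgraph) (u v : vert Kgraph) : gT :=
  if ends e == (u, v) then (val e).2 else (val e).2^-1.

Lemma Kgain_valV e u v : joins e u v -> u != v ->
  Kgain_val e u v = (Kgain_val e v u)^-1.
Proof.
rewrite /joins /Kgain_val => /orP[] /eqP-> nuv; rewrite !eqxx.
  by rewrite xpair_eqE (negPf nuv) /= invgK.
by rewrite xpair_eqE eq_sym (negPf nuv).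
Qed.

Definition Kgain : gain_fun gT Kgraph := GainFun Kgain_valV.

End CompleteGainGraph.

(* Main.v *)
Require Import Defs.
From mathcomp Require Import all_boot all_fingroup zify.

(** For an elementary lift, rank M - rank N takes values in {0, 1} and is
    monotone; call an edge set unlifted when it vanishes.  Adding a pendant edge,
    or the third edge of a psi-balanced triangle, preserves unliftedness, so a
    maximal connected unlifted set consists of all edges whose switched gain lies
    in some subgroup H.  Since n >= 4, one vertex can be deleted and reattached by
    an arbitrary pendant edge, hence the switching function is irrelevant and
    unliftedness becomes a property of H, invariant under conjugation.

    The family A consists of the maximal unlifted subgroups.  Every a outside
    Gamma_1 lies in one, as two parallel edges with gains 1 and a are independent
    in N, while an unlifted subgroup meets Gamma_1 trivially because a digon with
    gain in Gamma_1 is a circuit of N.  If x <> 1 is common to B and B', and x^g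
    lies in B', then splitting the vertices into two parts and switching one part
    by g gives two unlifted sets whose intersection contains unbalanced cycles on
    both sides and hence spans N; their union is unlifted by submodularity, so B,
    B' and g generate an unlifted subgroup.  With g = 1 this gives disjointness,
    with B = B' malnormality. *)

Set Implicit Arguments.
Unset Strict Implicit.
Unset Printing Implicit Defensive.

(** * Matroids and elementary lifts *)

Section Matroid.
Variables (E : finType) (M : matroid E).
Implicit Types (X Y I C : {set E}) (x y : E).

Lemma rank_setU1 x X : rank M (x |: X) <= (rank M X).+1.
Proof.
have := rank_submod M [set x] X; have := rank_card M [set x].
rewrite cards1; lia.
Qed.

(** Submodularity for [X] and [x |: I], whose intersection contains [I]. *)
Lemma rank_setU1_absorb x I X : I \subset X ->
  rank M (x |: I) <= rank M I -> rank M (x |: X) = rank M X.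
Proof.
move=> sIX le_xI; apply/eqP; rewrite eqn_leq [X in _ && X]rank_mono ?subsetUr // andbT.
have := rank_submod M X (x |: I).
have -> : X :|: (x |: I) = x |: X by rewrite setUCA (setUidPl sIX).
have /(rank_mono M) : I \subset X :&: (x |: I) by rewrite subsetI sIX subsetUr.
lia.
Qed.

Lemma rank_setU_absorb X Y :
  (forall y, y \in Y -> rank M (y |: X) = rank M X) -> rank M (X :|: Y) = rank M X.
Proof.
move=> absY; have [s eqYs] : exists s : seq E, Y =i s.
  by exists (enum Y) => y; rewrite mem_enum.
have -> : Y = [set y in s] by apply/setP=> y; rewrite inE eqYs.
have {eqYs} : {subset s <= Y} by move=> y; rewrite eqYs.
elim: s => [|y s IHs] sY; first by congr rank; apply/setP=> z; rewrite !inE orbF.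
have -> : X :|: [set z in y :: s] = y |: (X :|: [set z in s]).
  by apply/setP=> z; rewrite !inE orbCA.
rewrite (@rank_setU1_absorb y X) ?subsetUl //; last by rewrite absY // sY ?mem_head.
by apply: IHs => z sz; rewrite sY // inE sz orbT.
Qed.

Lemma rank_basis X :
  exists I, [/\ I \subset X, rank M I = #|I| & rank M X = rank M I].
Proof.
have [k] := ubnP #|X|; elim: k => // k IHk in X *; rewrite ltnS => leXk.
have [->|/set0Pn[x Xx]] := eqVneq X set0.
  exists set0; split=> //; apply/eqP; rewrite cards0 -leqn0 -(cards0 E).
  exact: rank_card.
have [|I [sIX rI eqI]] := IHk (X :\ x); first by rewrite (cardsD1 x X) Xx in leXk.
rewrite -(setD1K Xx); have /negPf xI : x \notin I.
  by apply/negP=> /(subsetP sIX); rewrite !inE eqxx.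
have [le_xI|lt_xI] := leqP (rank M (x |: I)) (rank M I).
  exists I; split=> //; first by rewrite subsetU ?sIX ?orbT.
  by rewrite (rank_setU1_absorb sIX).
exists (x |: I); rewrite setUS //; have := rank_setU1 x (X :\ x).
have := rank_card M (x |: I); have := rank_mono M (setUS [set x] sIX).
by rewrite cardsU1 xI add1n; split=> //; lia.
Qed.

Lemma circuit_dep C : circuit M C -> rank M C < #|C|.
Proof. by case/minsetP. Qed.

Lemma circuit_proper C X : circuit M C -> X \proper C -> rank M X = #|X|.
Proof.
case/minsetP=> _ minC /properP[sXC [x Cx nXx]].
apply/eqP; rewrite eqn_leq rank_card leqNgt; apply/negP=> depX.
by rewrite (minC X depX sXC) Cx in nXx.
Qed.

Lemma circuit_rank C : circuit M C -> (rank M C).+1 = #|C|.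
Proof.
move=> cC; have ltC := circuit_dep cC.
have /card_gt0P[x Cx] : 0 < #|C| by lia.
have := rank_mono M (subD1set C x).
rewrite (circuit_proper cC (properD1 Cx)) (cardsD1 x C) Cx; move: ltC.
by rewrite (cardsD1 x C) Cx; lia.
Qed.

Lemma dep_circuit X : rank M X < #|X| -> exists2 C, circuit M C & C \subset X.
Proof.
move=> depX; have [C cC sCX] :=
  @minset_exists E (fun Y : {set E} => rank M Y < #|Y|) X depX.
by exists C.
Qed.

Lemma circuit_span C x X : circuit M C -> x \in C -> C \subset x |: X ->
  rank M (x |: X) = rank M X.
Proof.
move=> cC Cx sCX; apply: (@rank_setU1_absorb x (C :\ x)).
  by rewrite subDset.
by rewrite setD1K // (circuit_proper cC (properD1 Cx)) -ltnS circuit_rank //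
  (cardsD1 x C) Cx.
Qed.

(** Fundamental circuit of [x] over a basis [I] of [X]: [x |: I] is dependent, and a circuit in it
    avoiding [x] would make [I] dependent. *)
Lemma span_circuit x X : x \notin X -> rank M (x |: X) = rank M X ->
  exists C, [/\ circuit M C, x \in C & C \subset x |: X].
Proof.
move=> nXx eqX; have [I [sIX rI eqI]] := rank_basis X.
have nIx : x \notin I by apply: contra nXx; apply/subsetP.
have [|C cC sCI] := @dep_circuit (x |: I).
  rewrite cardsU1 nIx add1n -rI -eqI -eqX ltnS.
  by apply: rank_mono; apply: setUS.
exists C; split=> //; last exact: subset_trans sCI (setUS _ sIX).
apply/negPn/negP=> nCx; have sC : C \subset I.
  apply/subsetP=> z Cz; have := subsetP sCI _ Cz; rewrite !inE => /orP[/eqP eqz|//].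
  by rewrite -eqz Cz in nCx.
suff: rank M I < #|I| by rewrite rI ltnn.
have := rank_submod M (I :&: C) (I :\: C); rewrite setID.
have := rank_card M (I :\: C); have := circuit_dep cC.
rewrite -(cardsID C I) (setIidPr sC); lia.
Qed.

End Matroid.

Section ElementaryLift.
Variables (E : finType) (M N : matroid E).
Hypothesis liftMN : elementary_lift M N.
Implicit Types (X Y C : {set E}).

(** The difference of the two ranks is monotone: in the common extension [K], this is submodularity
    for [X] with the new element added and [Y]. *)
Lemma lift_rank_diff X Y : X \subset Y ->
  rank M X + rank N Y <= rank N X + rank M Y.
Proof.
case: liftMN => K [delK conK] sXY; rewrite -!delK -!conK /= /del_rank /contr_rank.
have := rank_submod K (None |: Some @: X) (Some @: Y).
rewrite -setUA -imsetU (setUidPr sXY).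
have /(rank_mono K) : Some @: X \subset (None |: Some @: X) :&: (Some @: Y).
  by rewrite subsetI subsetUr imsetS.
have := rank_None_le K (Some @: X); have := rank_None_le K (Some @: Y).
rewrite /reverse_coercion; lia.
Qed.

Lemma lift_rank_bounds X : rank N X <= rank M X <= (rank N X).+1.
Proof.
case: liftMN => K [delK conK]; rewrite -!delK -!conK /= /del_rank /contr_rank.
have := rank_submod K [set None] (Some @: X).
have := rank_mono K (subsetUr [set None] (Some @: X)).
have := rank_None_le K (Some @: X).
by have := rank_card K [set None]; rewrite /reverse_coercion cards1; lia.
Qed.

Lemma lift_rank_eqS X Y : X \subset Y -> rank M Y = rank N Y -> rank M X = rank N X.
Proof. by move/lift_rank_diff; have /andP[] := lift_rank_bounds X; lia. Qed.

(** An [N]-basis [I] of [X] is independent in [M] too. Each further [y] lies in an [N]-circuit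
    inside [y |: I]; as that circuit has the same rank in [M], it also puts [y] in the [M]-closure
    of [I]. *)
Lemma lift_rank_eqP X :
  (forall C, circuit N C -> C \subset X -> rank M C = rank N C) ->
  rank M X = rank N X.
Proof.
move=> eqC; have [I [sIX rI eqXI]] := rank_basis N X.
have eqI : rank M I = rank N I.
  by have := rank_card M I; have /andP[] := lift_rank_bounds I; lia.
rewrite eqXI -eqI -(setUidPr sIX); apply: rank_setU_absorb => y Xy.
have [Iy|nIy] := boolP (y \in I); first by rewrite (setUidPr _) ?sub1set.
have sIyX : y |: I \subset X by rewrite subUset sub1set Xy.
have [|C [cC Cy sCI]] := @span_circuit _ N y I nIy.
  have := rank_mono N sIyX; have := rank_mono N (subsetUr [set y] I); lia.
apply: (@rank_setU1_absorb _ _ y (C :\ y)); rewrite ?subDset // setD1K //.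
rewrite eqC // ?(subset_trans sCI) //.
(* [C :\ y] is independent in [N], so its rank in [M] is at least [#|C| - 1], the rank of [C]. *)
have /andP[] := lift_rank_bounds (C :\ y).
rewrite (circuit_proper cC (properD1 Cy)); have := circuit_rank cC.
by rewrite (cardsD1 y C) Cy; lia.
Qed.

End ElementaryLift.

(** * Connectivity and vertex degrees of frame circuits *)

Section Graph.
Variable G : mgraph.
Local Notation V := (vert G).
Local Notation E := (edge G).
Implicit Types (X C P : {set E}) (e f : E) (u v w x y z : V) (p q : seq (E * V)).

Lemma joinsC e u v : joins e u v = joins e v u.
Proof. by rewrite /joins orbC. Qed.

Lemma joins_ends e u v u' v' : joins e u v -> joins e u' v' ->
  (u = u' /\ v = v') \/ (u = v' /\ v = u').
Proof.
rewrite /joins => /orP[]/eqP-> /orP[]/eqP[-> ->]; by [left | right].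
Qed.

Lemma vertsP X v :
  reflect (exists e u, e \in X /\ joins e u v) (v \in verts X).
Proof.
rewrite inE; apply: (iffP existsP) => [[e /andP[Xe /existsP[u ju]]]|[e [u [Xe ju]]]].
  by exists e, u.
by exists e; rewrite Xe; apply/existsP; exists u.
Qed.

Lemma joins_verts X e u v : e \in X -> joins e u v -> (u \in verts X) && (v \in verts X).
Proof.
by move=> Xe je; apply/andP; split; apply/vertsP;
  [exists e, v; rewrite joinsC | exists e, u].
Qed.

Lemma vertsU X P : verts (X :|: P) = verts X :|: verts P.
Proof.
apply/setP=> v; rewrite [RHS]inE; apply/vertsP/orP => [[e [u [/setUP[Xe|Pe] je]]]|].
- by left; apply/vertsP; exists e, u.
- by right; apply/vertsP; exists e, u.
by case=> /vertsP[e [u [Xe je]]]; exists e, u; rewrite inE Xe ?orbT.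
Qed.

Lemma walk_vertsE x p v : (v \in walk_verts x p) = (v \in x :: unzip2 p).
Proof. by rewrite in_set. Qed.

Lemma walk_edges_cons e y p : walk_edges ((e, y) :: p) = e |: walk_edges p.
Proof. by apply/setP=> f; rewrite !inE. Qed.

Lemma verts_walk_edges x p v : is_walk x p -> v \in verts (walk_edges p) ->
  v \in x :: unzip2 p.
Proof.
elim: p x => [|[e y] p IHp] x /=; first by move=> _ /vertsP[e [u []]]; rewrite in_set.
case/andP=> je wp /vertsP[f [u []]]; rewrite walk_edges_cons.
case/setU1P=> [->|pf] jf.
  by case: (joins_ends je jf) => [][-> ->]; rewrite !inE eqxx ?orbT.
by rewrite inE IHp ?orbT //; apply/vertsP; exists f, u.
Qed.

Definition adj X : rel V := fun u v => [exists e in X, joins e u v].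

Lemma adjP X u v : reflect (exists2 e, e \in X & joins e u v) (adj X u v).
Proof. exact: exists_inP. Qed.

Lemma adj_sym X : symmetric (adj X).
Proof. by move=> u v; apply: eq_existsb => e; rewrite joinsC. Qed.

Lemma connect_adjC X u v : connect (adj X) u v = connect (adj X) v u.
Proof. exact: (sym_connect_sym (adj_sym X)). Qed.

Lemma walk_connect X x p v : is_walk x p -> walk_edges p \subset X ->
  v \in x :: unzip2 p -> connect (adj X) x v.
Proof.
elim: p x => [|[e y] p IHp] x; first by rewrite /= inE => _ _ /eqP->.
rewrite walk_edges_cons subUset sub1set => /andP[je wp] /andP[Xe sp].
rewrite inE => /predU1P[->|pv] //.
by apply: connect_trans (IHp y wp sp pv); apply: connect1; apply/adjP; exists e.
Qed.

Lemma cycle_connect X C u v : is_cycle C -> C \subset X ->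
  u \in verts C -> v \in verts C -> connect (adj X) u v.
Proof.
case=> x [p [/and5P[wp _ _ _ _] ->]] sX up vp.
apply: (@connect_trans _ _ x); first rewrite connect_adjC.
  exact: walk_connect wp sX (verts_walk_edges wp up).
exact: walk_connect wp sX (verts_walk_edges wp vp).
Qed.

(** Connectedness seen from a fixed vertex, a form that survives adding edges one at a time. *)
Definition rooted X r := [forall v in verts X, connect (adj X) r v].

Lemma rootedP X r :
  reflect (forall v, v \in verts X -> connect (adj X) r v) (rooted X r).
Proof. exact: forall_inP. Qed.

Lemma connect_adjS X C : X \subset C -> subrel (connect (adj X)) (connect (adj C)).
Proof.
move=> /subsetP sXC; apply: connect_sub => u v /adjP[e Xe je].
by apply/connect1/adjP; exists e => //; apply: sXC.
Qed.

Lemma rooted_setU1 X r e u v : rooted X r -> joins e u v ->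
  connect (adj X) r u -> rooted (e |: X) r.
Proof.
move=> /rootedP rX je ru; apply/rootedP=> w.
have ru' := connect_adjS (subsetUr [set e] X) ru.
case/vertsP=> f [z [/setU1P[->|Xf] jf]]; last first.
  by apply: connect_adjS (rX w _); [apply: subsetUr | apply/vertsP; exists f, z].
case: (joins_ends je jf) => [][equ eqv]; last by rewrite -equ.
rewrite -eqv; apply: connect_trans ru' (connect1 _).
by apply/adjP; exists e; rewrite ?setU11.
Qed.

Lemma handcuff_rooted C1 C2 X : handcuff C1 C2 X -> exists r, rooted X r.
Proof.
case=> [[cC1 cC2 _ /eqP/cards1P[r /setP eqr] ->]|[cC1 cC2 _]].
  have := eqr r; rewrite in_setI in_set1 eqxx => /andP[rC1 rC2].
  exists r; apply/rootedP=> v; rewrite vertsU => /setUP[] vC.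
    by apply: cycle_connect vC => //; apply: subsetUl.
  by apply: cycle_connect vC => //; apply: subsetUr.
case=> x [y [p [/and3P[wp /eqP ep _] /setP/(_ x) xC1 /setP/(_ y) yC2 eqX]]].
move: xC1 yC2; rewrite !in_setI !in_set1 !eqxx => /andP[_ xC1] /andP[py yC2].
rewrite walk_vertsE in py.
have sp : walk_edges p \subset X by rewrite eqX subsetUr.
exists x; apply/rootedP=> v; rewrite {1}eqX !vertsU => /setUP[/setUP[]|] vC.
- by apply: cycle_connect vC => //; rewrite eqX -setUA subsetUl.
- apply: connect_trans (walk_connect wp sp py) _.
  by apply: cycle_connect vC => //; rewrite eqX setUAC subsetUr.
exact: walk_connect wp sp (verts_walk_edges wp vC).
Qed.

Lemma theta_rooted P1 P2 P3 X : theta P1 P2 P3 X -> exists r, rooted X r.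
Proof.
case=> u [v [p1 [p2 [p3 [_ [/and3P[w1 _ _] /and3P[w2 _ _] /and3P[w3 _ _]]]]]]].
case=> _ _ _ [-> -> ->] eqX.
exists u; apply/rootedP=> z; rewrite {1}eqX !vertsU => /setUP[/setUP[]|] vC;
  apply: walk_connect (verts_walk_edges _ vC) => //; rewrite eqX.
- by rewrite -setUA subsetUl.
- by rewrite setUAC subsetUr.
exact: subsetUr.
Qed.

(** * Vertex degrees in cycles, handcuffs and thetas *)

Definition two_edges_at X v :=
  exists e f, [/\ e \in X, f \in X, e != f, exists u, joins e u v & exists u, joins f u v].

Lemma two_edges_atS X C v : X \subset C -> two_edges_at X v -> two_edges_at C v.
Proof.
by move=> /subsetP sXC [e [f [Xe Xf nef je jf]]]; exists e, f; split; rewrite ?sXC.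
Qed.

Lemma is_walk_cat x p q : is_walk x (p ++ q) = is_walk x p && is_walk (walk_end x p) q.
Proof.
by elim: p x => [|[e y] p IHp] x //=; rewrite IHp andbA.
Qed.

Lemma walk_split p v : v \in unzip2 p ->
  exists p1 e p2, p = p1 ++ (e, v) :: p2.
Proof.
case/mapP=> -[e y] /= pe ->; case/splitPr: pe => p1 p2.
by exists p1, e, p2.
Qed.

Hypothesis loopless : forall e u v, joins e u v -> u != v.

Lemma cycle_two_edges C v : is_cycle C -> v \in verts C -> two_edges_at C v.
Proof.
case=> x [p [/and5P[wp _ /eqP endp uV uE] ->]] Cv.
have {Cv}: v \in unzip2 p.
  have := verts_walk_edges wp Cv; rewrite inE => /predU1P[eqv|//].
  case: p wp endp Cv {uV uE} => [|[e y] p] /= wp endp Cv.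
    by case/vertsP: Cv => e [u []]; rewrite in_set.
  by rewrite eqv -endp /walk_end /= mem_last.
case/walk_split=> p1 [e [p2 eqp]]; subst p.
move: wp uE; rewrite is_walk_cat /= => /and3P[w1 je w2].
rewrite /unzip1 map_cat /= cat_uniq /= negb_or => /and4P[_ /andP[e1 _] e2 _].
have sub f : f \in unzip1 p1 ++ e :: unzip1 p2 -> f \in walk_edges (p1 ++ (e, v) :: p2).
  by rewrite in_set /unzip1 map_cat.
case: p2 => [|[f z] p2] in w2 e2 endp sub uV *; last first.
  case/andP: w2 => jf _; exists e, f; split.
  - by rewrite sub // mem_cat mem_head orbT.
  - by rewrite sub // mem_cat !inE eqxx !orbT.
  - by apply: contraNneq e2 => ->; rewrite mem_head.
  - by exists (walk_end x p1).
  - by exists z; rewrite joinsC.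
(* Here [e] is the last edge, so [v] is the base vertex and the other edge is the first one of the
   walk; if there were none, [e] would be a loop. *)
move: endp; rewrite /walk_end /unzip2 map_cat /= last_cat /= => eqv; subst x.
case: p1 => [|[f z] p1] in w1 je e1 sub uV *.
  by have := loopless je; rewrite /walk_end /= eqxx.
case/andP: w1 => jf _; exists e, f; split.
- by rewrite sub // mem_cat mem_head orbT.
- by rewrite sub // mem_head.
- by apply: contraNneq e1 => ->; rewrite mem_head.
- by exists (walk_end v ((f, z) :: p1)).
- by exists z; rewrite joinsC.
Qed.

Lemma path_two_edges x y p v : is_path x y p ->
  v \in verts (walk_edges p) -> v != x -> v != y -> two_edges_at (walk_edges p) v.
Proof.
case/and3P=> wp /eqP endp uV pv nvx nvy.
have := verts_walk_edges wp pv; rewrite inE (negPf nvx) /= => /walk_split[p1 [e [p2 eqp]]].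
subst p; move: wp; rewrite is_walk_cat /= => /and3P[w1 je w2].
case: p2 => [|[f z] p2] in w2 endp uV pv *.
  by rewrite -endp /walk_end /unzip2 map_cat last_cat eqxx in nvy.
case/andP: w2 => jf _; exists e, f; split.
- by rewrite in_set /unzip1 map_cat mem_cat mem_head orbT.
- by rewrite in_set /unzip1 map_cat mem_cat !inE eqxx !orbT.
(* Leaving [v] by the edge just used leads to [v] itself or to the preceding vertex, and a path
   repeats neither. *)
- apply/eqP=> eqef; rewrite -eqef in jf.
  case: (joins_ends je jf) => [[_ eqvz]|[eqz _]].
    by move: uV; rewrite /unzip2 map_cat /= eqvz cat_uniq /= mem_head !andbF.
  have: z \in x :: unzip2 p1 by rewrite -eqz mem_last.
  move: uV; rewrite /unzip2 map_cat -cat_cons cat_uniq => /and3P[_ /hasPn dis _].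
  by apply/negP/dis; rewrite /= !inE eqxx orbT.
- by exists (walk_end x p1).
- by exists z; rewrite joinsC.
Qed.

Lemma path_first_edge x y p : is_path x y p -> x != y ->
  exists2 e, e \in walk_edges p & exists u, joins e u x.
Proof.
case: p => [|[e z] p] /and3P[]; first by move=> _ /eqP; rewrite /walk_end /= => ->; rewrite eqxx.
move=> /andP[je _] _ _ _; exists e; first by rewrite walk_edges_cons setU11.
by exists z; rewrite joinsC.
Qed.

Lemma path_last_edge x y p : is_path x y p -> x != y ->
  exists2 e, e \in walk_edges p & exists u, joins e u y.
Proof.
case/and3P=> + /eqP <- _; case/lastP: p => [|p [e z]]; first by rewrite /walk_end /= eqxx.
rewrite -cats1 is_walk_cat /= /walk_end /unzip2 map_cat last_cat /= => /and3P[_ je _] _.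
exists e; last by exists (walk_end x p).
by rewrite in_set /unzip1 map_cat mem_cat mem_head orbT.
Qed.

Lemma handcuff_two_edges C1 C2 X v : handcuff C1 C2 X -> v \in verts X -> two_edges_at X v.
Proof.
case=> [[cC1 cC2 _ _ ->]|[cC1 cC2 _]].
  rewrite vertsU => /setUP[] Cv.
    exact: two_edges_atS (subsetUl _ _) (cycle_two_edges cC1 Cv).
  exact: two_edges_atS (subsetUr _ _) (cycle_two_edges cC2 Cv).
case=> x [y [p [pathp /setP/(_ x) xC1 /setP/(_ y) yC2 ->]]].
move: xC1 yC2; rewrite !in_setI !in_set1 !eqxx => /andP[_ xC1] /andP[_ yC2].
have s1 : C1 \subset C1 :|: C2 :|: walk_edges p by rewrite -setUA subsetUl.
have s2 : C2 \subset C1 :|: C2 :|: walk_edges p by rewrite setUAC subsetUr.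
rewrite !vertsU => /setUP[/setUP[] Cv|pv].
- exact: two_edges_atS s1 (cycle_two_edges cC1 Cv).
- exact: two_edges_atS s2 (cycle_two_edges cC2 Cv).
have [->|nvx] := eqVneq v x; first exact: two_edges_atS s1 (cycle_two_edges cC1 xC1).
have [->|nvy] := eqVneq v y; first exact: two_edges_atS s2 (cycle_two_edges cC2 yC2).
exact: two_edges_atS (subsetUr _ _) (path_two_edges pathp pv nvx nvy).
Qed.

(** At the two branch vertices the edges come from two different paths; elsewhere, from the single
    path through the vertex. *)
Lemma theta_two_edges P1 P2 P3 X z : theta P1 P2 P3 X -> z \in verts X -> two_edges_at X z.
Proof.
case=> u [v [p1 [p2 [p3 [nuv [t1 t2 t3] [[_ d12] _ _] [-> -> ->] ->]]]]] Xz.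
have s1 : walk_edges p1 \subset walk_edges p1 :|: walk_edges p2 :|: walk_edges p3.
  by rewrite -setUA subsetUl.
have s2 : walk_edges p2 \subset walk_edges p1 :|: walk_edges p2 :|: walk_edges p3.
  by rewrite setUAC subsetUr.
have two e f : e \in walk_edges p1 -> f \in walk_edges p2 ->
    (exists w, joins e w z) -> (exists w, joins f w z) ->
    two_edges_at (walk_edges p1 :|: walk_edges p2 :|: walk_edges p3) z.
  move=> p1e p2f je jf; exists e, f; split=> //; first exact: (subsetP s1).
    exact: (subsetP s2).
  by apply: contraTneq p2f => <-; rewrite (disjointFr d12).
have [eqz|nzu] := eqVneq z u.
  have [e p1e je] := path_first_edge t1 nuv; have [f p2f jf] := path_first_edge t2 nuv.
  by apply: (two e f); rewrite ?eqz.
have [eqz|nzv] := eqVneq z v.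
  have [e p1e je] := path_last_edge t1 nuv; have [f p2f jf] := path_last_edge t2 nuv.
  by apply: (two e f); rewrite ?eqz.
move: Xz; rewrite !vertsU => /setUP[/setUP[]|] pz.
- exact: two_edges_atS s1 (path_two_edges t1 pz nzu nzv).
- exact: two_edges_atS s2 (path_two_edges t2 pz nzu nzv).
exact: two_edges_atS (subsetUr _ _) (path_two_edges t3 pz nzu nzv).
Qed.

(** * Digons and triangles *)

Lemma verts_digon e f u v : joins e u v -> joins f u v -> verts [set e; f] = [set u; v].
Proof.
move=> je jf; apply/setP=> w; apply/vertsP/set2P => [[g [z [/set2P[]-> jg]]]|].
- by case: (joins_ends je jg) => [[_ <-]|[<- _]]; [right | left].
- by case: (joins_ends jf jg) => [[_ <-]|[<- _]]; [right | left].
case=> ->; [exists e, v | exists e, u]; rewrite !inE eqxx ?je //.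
by rewrite joinsC je.
Qed.

Lemma digon_walk e f u v : e != f -> joins e u v -> joins f u v ->
  simple_closed_walk u [:: (e, v); (f, u)].
Proof.
move=> nef je jf; rewrite /simple_closed_walk /= je joinsC jf /walk_end /= eqxx.
by rewrite !inE nef eq_sym (loopless je).
Qed.

Lemma digon_cycle e f u v : e != f -> joins e u v -> joins f u v -> is_cycle [set e; f].
Proof.
move=> nef je jf; exists u, [:: (e, v); (f, u)]; split; first exact: digon_walk.
by apply/setP=> g; rewrite !inE.
Qed.

Section Gain.
Variables (gT : finGroupType) (psi : gain_fun gT G).
Local Open Scope group_scope.

Lemma balanced_cycle C : balanced psi C -> is_cycle C.
Proof. by case=> x [p [scp -> _]]; exists x, p. Qed.

Lemma frame_circuit_two_edges C v :
  frame_circuit psi C -> v \in verts C -> two_edges_at C v.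
Proof.
case=> [/balanced_cycle|[C1 [C2 [hC _ _]]]|[P1 [P2 [P3 [tC _ _ _]]]]].
- exact: cycle_two_edges.
- exact: handcuff_two_edges hC.
exact: theta_two_edges tC.
Qed.

Lemma balanced_triangle e1 e2 e3 u v w : uniq [:: u; v; w] ->
    joins e1 u v -> joins e2 v w -> joins e3 u w ->
  psi e1 u v * psi e2 v w = psi e3 u w -> balanced psi [set e1; e2; e3].
Proof.
rewrite /= !inE negb_or andbT => /andP[/andP[nuv nuw] nvw] j1 j2 j3 eqg.
have [Nuv Nuw Nvw] : [/\ u <> v, u <> w & v <> w] by split; apply/eqP.
have n12 : e1 != e2.
  by apply/eqP=> e12; rewrite -e12 in j2; case: (joins_ends j1 j2) => [][]; congruence.
have n13 : e1 != e3.
  by apply/eqP=> e13; rewrite -e13 in j3; case: (joins_ends j1 j3) => [][]; congruence.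
have n23 : e2 != e3.
  by apply/eqP=> e23; rewrite -e23 in j3; case: (joins_ends j2 j3) => [][]; congruence.
exists u, [:: (e1, v); (e2, w); (e3, u)]; split.
- rewrite /simple_closed_walk /= j1 j2 joinsC j3 /walk_end /= eqxx.
  by rewrite !inE !negb_or n12 n13 n23 nvw eq_sym nuv eq_sym nuw.
- by apply/setP=> f; rewrite !inE orbA.
by rewrite /= mulg1 mulgA eqg (gainV _ j3 nuw) mulVg.
Qed.

Lemma balanced_digon e f u v : e != f -> joins e u v -> joins f u v ->
  psi e u v = psi f u v -> balanced psi [set e; f].
Proof.
move=> nef je jf eqg; exists u, [:: (e, v); (f, u)]; split.
- exact: digon_walk.
- by apply/setP=> g; rewrite !inE.
by rewrite /= mulg1 eqg (gainV _ jf (loopless jf)) mulVg.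
Qed.

Lemma balanced_digon_gain e f u v : e != f -> joins e u v -> joins f u v ->
  balanced psi [set e; f] -> psi e u v = psi f u v.
Proof.
(* The witnessing walk has length 2, but it may start at either end and use the edges in either
   order. *)
move=> nef je jf [x [p [/and5P[wp _ /eqP endp uV uE] eqE gp]]].
have: size p = 2.
  have := congr1 (fun C : {set E} => #|C|) eqE.
  by rewrite /walk_edges cards2 nef cardsE (card_uniqP uE) size_map => <-.
case: p wp endp uV uE eqE gp => [|[e1 y] [|[e2 z] []]] //= + endp _ + eqE + _.
move: endp; rewrite /walk_end /= => eqz; subst z => /and3P[j1 j2 _].
rewrite inE andbT mulg1 => n12.
have nxy := loopless j1; rewrite (gainV _ j2) 1?eq_sym // => /eqP.
rewrite -eq_mulgV1 => /eqP eqg.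
have : [set e1; e2] = [set e; f] by rewrite eqE; apply/setP=> g; rewrite !inE.
move=> /setP eqs; have := eqs e1; have := eqs e2; rewrite !inE !eqxx orbT /=.
move=> /esym e2ef /esym e1ef.
have {e1ef e2ef} [eqef jexy jfxy] : [/\ psi e x y = psi f x y, joins e x y & joins f x y].
  rewrite joinsC in j2.
  case/orP: e1ef => /eqP eq1; case/orP: e2ef => /eqP eq2; subst e1 e2 => //.
  - by rewrite eqxx in n12.
  - by rewrite eqxx in n12.
case: (joins_ends je jexy) => [][-> ->] //.
by apply: invg_inj; rewrite -!gainV.
Qed.

End Gain.
End Graph.

(** * Triangle-closed sets of edges of the complete gain graph *)

Section CompleteGainGraph.
Variables (gT : finGroupType) (n : nat).
Local Open Scope group_scope.
Local Notation G := (Kgraph gT n).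
Local Notation V := (vert G).
Local Notation E := (edge G).
Local Notation psi := (Kgain gT n).
Implicit Types (X T : {set E}) (e f : E) (u v w : V) (eta : V -> gT) (H : {group gT}).

Lemma Kgraph_loopless e u v : joins e u v -> u != v.
Proof.
have := valP e; rewrite /joins /= => lt_e /orP[]/eqP eqe;
  move: lt_e; rewrite eqe /=; apply: contraTneq => ->; by rewrite ltnn.
Qed.

Lemma Kedge_joins e : exists u v, joins e u v.
Proof.
by exists (val e).1.1, (val e).1.2; rewrite /joins /=; case: (val e).1 => i j; rewrite eqxx.
Qed.

Lemma Kedge_exists u v a : u != v -> exists2 e, joins e u v & psi e u v = a.
Proof.
move=> nuv; have: (u < v)%N || (v < u)%N by rewrite -neq_ltn.
case/orP=> lt.
  exists (Sub (u, v, a) lt : Kedge gT n); rewrite /joins /= ?/Kgain_val /= ?SubK /= ?eqxx //.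
exists (Sub (v, u, a^-1) lt : Kedge gT n); rewrite /joins /= ?/Kgain_val /= ?SubK /= ?eqxx ?orbT //.
by rewrite xpair_eqE eq_sym (negPf nuv) /= invgK.
Qed.

Lemma Kedge_inj e f u v : joins e u v -> joins f u v -> psi e u v = psi f u v -> e = f.
Proof.
move=> je jf; have nuv := Kgraph_loopless je; rewrite /= /Kgain_val.
have npair : (v, u) == (u, v) = false by rewrite xpair_eqE eq_sym (negPf nuv).
have lte := valP e; have ltf := valP f; move: je jf; rewrite /joins /=.
move=> /orP[]/eqP je /orP[]/eqP jf; rewrite je jf ?eqxx ?npair => eqg.
- by apply/val_inj; rewrite [LHS]surjective_pairing [RHS]surjective_pairing je jf eqg.
- by move: lte ltf; rewrite je jf /= => lt1 /(ltn_trans lt1); rewrite ltnn.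
- by move: lte ltf; rewrite je jf /= => lt1 /(ltn_trans lt1); rewrite ltnn.
apply/val_inj; rewrite [LHS]surjective_pairing [RHS]surjective_pairing je jf.
by rewrite (invg_inj eqg).
Qed.

(** Going through [gain_set] makes containment in this set the very condition on handcuffs and
    thetas in [lift_circuit]. *)
Definition gain_subgraph (H : {group gT}) eta : {set E} :=
  [set e | gain_set (switch psi eta) [set e] \subset H].

Lemma gain_subgraphE H eta e u v : joins e u v ->
  (e \in gain_subgraph H eta) = ((eta u)^-1 * psi e u v * eta v \in H).
Proof.
move=> je; rewrite inE; apply/subsetP/idP => [|He a]; last first.
  rewrite inE => /existsP[f /andP[/set1P-> /existsP[u' /existsP[v' /andP[je' /eqP->]]]]].
  case: (joins_ends je je') => [][<- <-] //=.
  have nuv := Kgraph_loopless je.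
  have -> := @switch_gainV _ _ psi eta e v u _ _; rewrite ?groupV //; first by rewrite joinsC.
  by rewrite eq_sym.
apply; rewrite inE; apply/existsP; exists e; rewrite set11 /=.
by apply/existsP; exists u; apply/existsP; exists v; rewrite je /=.
Qed.

Lemma sub_gain_subgraph H eta X :
  (X \subset gain_subgraph H eta) = (gain_set (switch psi eta) X \subset H).
Proof.
apply/subsetP/subsetP => [sX a|sX e Xe].
  rewrite inE => /existsP[e /andP[Xe /existsP[u /existsP[v /andP[je /eqP->]]]]].
  by have := sX e Xe; rewrite (gain_subgraphE _ _ je).
have [u [v je]] := Kedge_joins e; rewrite (gain_subgraphE _ _ je).
apply: sX; rewrite inE; apply/existsP; exists e; rewrite Xe.
by apply/existsP; exists u; apply/existsP; exists v; rewrite je /=.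
Qed.

Lemma eq_gain_subgraph H eta eta' : eta =1 eta' ->
  gain_subgraph H eta = gain_subgraph H eta'.
Proof.
move=> eq_eta; apply/setP=> e; have [u [v je]] := Kedge_joins e.
by rewrite !(gain_subgraphE _ _ je) !eq_eta.
Qed.

Definition triangle_closed T := forall e1 e2 e3 u v w,
  uniq [:: u; v; w] -> joins e1 u v -> joins e2 v w -> joins e3 u w ->
  psi e1 u v * psi e2 v w = psi e3 u w -> e1 \in T -> e2 \in T -> e3 \in T.

Lemma gain_subgraph_triangle_closed H eta : triangle_closed (gain_subgraph H eta).
Proof.
move=> e1 e2 e3 u v w _ j1 j2 j3 eqg.
rewrite (gain_subgraphE _ _ j1) (gain_subgraphE _ _ j2) (gain_subgraphE _ _ j3) -eqg.
by move=> H1 H2; have := groupM H1 H2; rewrite !mulgA mulgK.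
Qed.

Hypothesis n_ge4 : (4 <= n)%N.

Lemma fresh_vertex (s : seq V) : (size s < 4)%N -> exists w, w \notin s.
Proof.
move=> lts; apply/existsP; rewrite -negb_forall; apply/negP=> /forallP sV.
have: (#|V| <= size s)%N by apply: leq_trans (card_size s); apply/subset_leq_card/subsetP.
rewrite [#|_|]card_ord; lia.
Qed.

Section Switched.
Variables (T : {set E}) (eta : V -> gT) (r : V).
Hypothesis closedT : triangle_closed T.

(** An edge is determined by its ends and its gain, so membership in [T] can be computed with gains
    alone. *)
Definition has_gain u v a :=
  [exists e in T, joins e u v && ((eta u)^-1 * psi e u v * eta v == a)].

Lemma has_gainP u v a :
  reflect (exists e, [/\ e \in T, joins e u v & (eta u)^-1 * psi e u v * eta v = a])
          (has_gain u v a).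
Proof.
apply: (iffP exists_inP) => [[e Te /andP[je /eqP ae]]|[e [Te je /eqP ae]]]; exists e => //.
by rewrite je.
Qed.

Lemma has_gainV u v a : has_gain u v a -> has_gain v u a^-1.
Proof.
case/has_gainP=> e [Te je <-]; apply/has_gainP; exists e; rewrite joinsC; split=> //.
by rewrite (switch_gainV _ _ je) ?invgK // (Kgraph_loopless je).
Qed.

Lemma has_gainM u v w a b : u != w -> has_gain u v a -> has_gain v w b ->
  has_gain u w (a * b).
Proof.
move=> nuw /has_gainP[e [Te je <-]] /has_gainP[f [Tf jf <-]].
have [g jg eqg] := @Kedge_exists u w (psi e u v * psi f v w) nuw.
apply/has_gainP; exists g; split=> //; last by rewrite eqg !mulgA mulgK.
apply: (@closedT e f g u v w) => //; rewrite /= !inE negb_or nuw.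
by rewrite (Kgraph_loopless je) (Kgraph_loopless jf).
Qed.

Lemma has_gain_mem e u v : joins e u v ->
  has_gain u v ((eta u)^-1 * psi e u v * eta v) -> e \in T.
Proof.
move=> je /has_gainP[f [Tf jf eqg]]; suff -> : e = f by [].
by apply: Kedge_inj je jf _; apply/(mulgI (eta u)^-1)/(mulIg (eta v)).
Qed.

(** The switching function normalises a spanning star of [T] centred at [r] to gain 1. *)
Hypothesis has_gain_root : forall v, v != r -> has_gain r v 1.

Lemma has_gain1 u v : u != v -> has_gain u v 1.
Proof.
move=> nuv; have [eqv|nvr] := eqVneq v r.
  by rewrite eqv -invg1 has_gainV // has_gain_root // -eqv.
have [->|nur] := eqVneq u r; first exact: has_gain_root.
rewrite -(mulg1 1); apply: (has_gainM nuv) (has_gain_root nvr).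
by rewrite -invg1 has_gainV // has_gain_root.
Qed.

Lemma has_gain_target u v w a : u != w -> has_gain u v a -> has_gain u w a.
Proof.
move=> nuw uva; have [<- //|nvw] := eqVneq v w.
by rewrite -(mulg1 a); apply: has_gainM uva (has_gain1 nvw).
Qed.

Lemma has_gain_source u v w a : w != v -> has_gain u v a -> has_gain w v a.
Proof.
move=> nwv uva; have [<- //|nuw] := eqVneq u w.
by rewrite -(mul1g a); apply: has_gainM (uva) => //; rewrite has_gain1 // eq_sym.
Qed.

(** Since gain 1 occurs between any two vertices, triangles move one end at a time. The detour
    through [w] keeps the ends distinct, even when the pair is to be reversed. *)
Lemma has_gain_move u v u' v' a : u' != v' -> has_gain u v a -> has_gain u' v' a.
Proof.
move=> nuv' uva; have [w] := @fresh_vertex [:: u; u'] isT.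
rewrite !inE negb_or => /andP[nwu nwu'].
rewrite eq_sym in nwu; rewrite eq_sym in nwu'.
exact: has_gain_target nuv' (has_gain_source nwu' (has_gain_target nwu uva)).
Qed.

(** The group consists of the gains seen on one pair of vertices, which by [has_gain_move] are those
    of every pair. A product is realised along a path through a third vertex. *)
Lemma triangle_closedE : exists H, T = gain_subgraph H eta.
Proof.
have [v0 _] := @fresh_vertex [::] isT; have [v1] := @fresh_vertex [:: v0] isT.
rewrite inE eq_sym => n01.
have gH : group_set [set a | has_gain v0 v1 a].
  apply/group_setP; split=> [|a b]; rewrite !inE; first exact: has_gain1.
  have [v2] := @fresh_vertex [:: v0; v1] isT; rewrite !inE negb_or => /andP[n20 n21] ga gb.
  rewrite eq_sym in n20.
  exact: has_gainM n01 (has_gain_target n20 ga) (has_gain_source n21 gb).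
exists (Group gH); apply/setP=> e; have [u [v je]] := Kedge_joins e.
have nuv := Kgraph_loopless je; rewrite (gain_subgraphE _ _ je) inE.
apply/idP/idP => [Te|/(has_gain_move nuv)/(has_gain_mem je)//].
by apply: (@has_gain_move u v) => //; apply/has_gainP; exists e.
Qed.

End Switched.

(** A path from [r] is shortened step by step: its first edge, once replaced by a direct edge from
    [r], and the next one span a balanced triangle. *)
Lemma adj_triangle_closed T r v : triangle_closed T -> connect (adj T) r v ->
  v != r -> adj T r v.
Proof.
move=> closedT /connectP[p]; elim/last_ind: p v => [|p w IHp] v /=.
  by move=> _ ->; rewrite eqxx.
rewrite rcons_path last_rcons => /andP[pathp adjw] -> nwr; set u := last r p in adjw *.
have [equ|nur] := eqVneq u r; first by rewrite -equ.
have /adjP[e Te je] := IHp u pathp erefl nur; case/adjP: adjw => f Tf jf.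
have nrw : r != w by rewrite eq_sym.
have [g jg eqg] := @Kedge_exists r w (psi e r u * psi f u w) nrw.
apply/adjP; exists g => //; apply: (closedT e f g r u w) => //.
by rewrite /= !inE negb_or nrw (Kgraph_loopless je) (Kgraph_loopless jf).
Qed.

Lemma rooted_triangle_closedE T r : triangle_closed T ->
  (forall v, connect (adj T) r v) -> exists H eta, T = gain_subgraph H eta.
Proof.
move=> closedT rT.
(* This gives the chosen edge from [r] to [v] switched gain 1. The default is taken at [r] only,
   since there are no loops and [r] is adjacent to all other vertices. *)
pose eta v := if [pick e in T | joins e r v] is Some e then (psi e r v)^-1 else 1.
suff /(triangle_closedE closedT) [H ->] : forall v, v != r -> has_gain T eta r v 1.
  by exists H, eta.
move=> v nvr; have /adjP[f Tf jf] := adj_triangle_closed closedT (rT v) nvr.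
have eta_r : eta r = 1.
  by rewrite /eta; case: pickP => // e /andP[_ /Kgraph_loopless]; rewrite eqxx.
apply/has_gainP; rewrite eta_r /eta; case: pickP => [e /andP[Te je]|/(_ f)].
  by exists e; split=> //; rewrite invg1 mul1g mulgV.
by rewrite Tf jf.
Qed.

End CompleteGainGraph.

(** * Unlifted edge sets and unlifted subgroups *)

Section Lift.
Variables (gT : finGroupType) (G1 : {group gT}) (n : nat).
Local Open Scope group_scope.
Local Notation G := (Kgraph gT n).
Local Notation V := (vert G).
Local Notation E := (edge G).
Local Notation psi := (Kgain gT n).
Variables N M : matroid E.
Hypothesis normalG1 : G1 <| [set: gT].
Hypothesis n_ge4 : (4 <= n)%N.
Hypothesis frameN : is_frame_matroid (quo_gain G1 psi) N.
Hypothesis liftMN : elementary_lift M N.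
Hypothesis cyclesM : forall C : {set E}, is_cycle C -> (circuit M C <-> balanced psi C).
Implicit Types (X Y T C : {set E}) (e f : E) (u v w r : V) (eta : V -> gT).
Implicit Types (H J B : {group gT}) (a x g : gT).

Definition unlifted X := rank M X == rank N X.

Lemma unliftedS X Y : X \subset Y -> unlifted Y -> unlifted X.
Proof. by move=> sXY /eqP eqY; apply/eqP; apply: lift_rank_eqS eqY. Qed.

Lemma unlifted_indep X : rank N X = #|X| -> unlifted X.
Proof.
move=> indX; have /andP[leNM _] := lift_rank_bounds liftMN X.
by rewrite /unlifted eqn_leq leNM indX rank_card.
Qed.

(** All four sets in the submodular inequality have full rank in [N]. The intersection has at least
    that rank in [M], which leaves at most that rank for the union. *)
Lemma unlifted_setU X Y : unlifted X -> unlifted Y ->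
  rank N (X :&: Y) = rank N [set: E] -> unlifted (X :|: Y).
Proof.
move=> /eqP eqX /eqP eqY spanXY; have := rank_submod M X Y; rewrite eqX eqY.
have /andP[leI _] := lift_rank_bounds liftMN (X :&: Y).
have /andP[leU _] := lift_rank_bounds liftMN (X :|: Y).
have := rank_mono N (subsetT X); have := rank_mono N (subsetT Y).
have /(rank_mono N) : X :&: Y \subset X :|: Y by rewrite subIset ?subsetUl.
by rewrite /unlifted; lia.
Qed.

(** A set dependent in [M] is dependent in [N], so a circuit of [N] that is dependent in [M] is
    already minimal there. *)
Lemma unlifted_circuit C : circuit N C -> (unlifted C <-> circuit M C).
Proof.
move=> cC; split=> [/eqP eqC|cMC]; last first.
  by apply/eqP/succn_inj; rewrite (circuit_rank cC) (circuit_rank cMC).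
have [depC minC] := minsetP cC; apply/minsetP; split=> [|B depB sBC]; first by rewrite eqC.
by apply: minC => //; apply: leq_ltn_trans depB; have /andP[] := lift_rank_bounds liftMN B.
Qed.

(** Frame circuits have two edges at each of their vertices, so none inside [e |: X] uses [e]. The
    rank of [N] grows by one, and that of [M] by at most one. *)
Lemma unlifted_pendant X e u w : unlifted X -> joins e u w -> w \notin verts X ->
  unlifted (e |: X).
Proof.
move=> /eqP eqX je Xw.
have Xe : e \notin X by apply: contra Xw => Xe; case/andP: (joins_verts Xe je).
suff neqN : rank N (e |: X) <> rank N X.
  have /andP[leNM _] := lift_rank_bounds liftMN (e |: X).
  have := rank_mono N (subsetUr [set e] X); have := rank_setU1 M e X.
  by rewrite /unlifted; lia.
case/(span_circuit Xe)=> C [/frameN fC Ce /subsetP sCX].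
have /andP[_ Cw] := joins_verts Ce je.
have [f1 [f2 [Cf1 Cf2 nf [u1 j1] [u2 j2]]]] :=
  frame_circuit_two_edges (@Kgraph_loopless gT n) fC Cw.
have verts_w f v : f \in C -> joins f v w -> f = e.
  move=> Cf jf; have := sCX f Cf; case/setU1P=> // Xf.
  by case/andP: (joins_verts Xf jf) => _; rewrite (negPf Xw).
by rewrite (verts_w f1 u1) // (verts_w f2 u2) // eqxx in nf.
Qed.

(** The triangle is a circuit of [M], so adding [e3] leaves the rank of [M] unchanged. *)
Lemma unlifted_triangle X e1 e2 e3 u v w : uniq [:: u; v; w] ->
    joins e1 u v -> joins e2 v w -> joins e3 u w ->
    psi e1 u v * psi e2 v w = psi e3 u w -> e1 \in X -> e2 \in X ->
  unlifted X -> unlifted (e3 |: X).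
Proof.
move=> uvw j1 j2 j3 eqg X1 X2 /eqP eqX.
have bal := balanced_triangle uvw j1 j2 j3 eqg.
have /cyclesM[_ /(_ bal) cC] := balanced_cycle bal.
have sC : [set e1; e2; e3] \subset e3 |: X.
  by apply/subsetP=> f; rewrite !inE => /orP[/orP[]|] /eqP->; rewrite ?X1 ?X2 ?eqxx ?orbT.
have := circuit_span cC _ sC; rewrite !inE eqxx orbT => /(_ isT) eqM.
have /andP[leNM _] := lift_rank_bounds liftMN (e3 |: X).
by have := rank_mono N (subsetUr [set e3] X); rewrite /unlifted; lia.
Qed.

Lemma unlifted_closure X r : unlifted X -> rooted X r ->
  exists H eta, X \subset gain_subgraph H eta /\ unlifted (gain_subgraph H eta).
Proof.
move=> unX rX; have [|T maxT sXT] := @maxset_exists _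
  [pred Y : {set E} | unlifted Y && rooted Y r] X; first by rewrite /= unX.
have /maxsetP[/andP[unT rT] maxT'] := maxT.
have addT e u v : joins e u v -> connect (adj T) r u -> unlifted (e |: T) -> e \in T.
  move=> je ru unTe; rewrite -(maxT' (e |: T)) ?setU11 ?subsetUr //.
  by rewrite inE /= unTe (rooted_setU1 rT je ru).
(* Otherwise a pendant edge from [r] to [v] would enlarge [T]. *)
have vertsT v : v != r -> v \in verts T.
  move=> nvr; apply/negPn/negP=> Tv; have nrv : r != v by rewrite eq_sym.
  have [e je _] := Kedge_exists 1 nrv.
  have Te := addT e r v je (connect0 _ _) (unlifted_pendant unT je Tv).
  by case/andP: (joins_verts Te je) => _; rewrite (negPf Tv).
have connT v : connect (adj T) r v.
  have [-> //|nvr] := eqVneq v r; exact: (rootedP _ _ rT _ (vertsT v nvr)).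
have closedT : triangle_closed T.
  move=> e1 e2 e3 u v w uvw j1 j2 j3 eqg T1 T2.
  exact: addT j3 (connT u) (unlifted_triangle uvw j1 j2 j3 eqg T1 T2 unT).
have [H [eta eqT]] := rooted_triangle_closedE n_ge4 closedT connT.
by exists H, eta; rewrite -eqT.
Qed.

(** Remove all edges at [w], reattach [w] by one pendant edge whose gain is dictated by the new
    value at [w], and take the closure. Balanced triangles then recover every edge of the newly
    switched subgraph. *)
Lemma unlifted_switch1 H eta w b : unlifted (gain_subgraph H eta) ->
  unlifted (gain_subgraph H (fun v => if v == w then b else eta v)).
Proof.
move=> unH; set eta' := fun v => _.
have [w0] := @fresh_vertex gT n n_ge4 [:: w] isT; rewrite inE => nw0.
have eta'E v : v != w -> eta' v = eta v by rewrite /eta' => /negPf->.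
pose X := [set e in gain_subgraph H eta | ~~ [exists u, joins e u w]].
have Xw : w \notin verts X.
  apply/vertsP=> -[e [u []]]; rewrite inE => /andP[_ /existsPn/(_ u)/negPf->] //.
have memX e u v : u != w -> v != w -> joins e u v ->
    (eta' u)^-1 * psi e u v * eta' v \in H -> e \in X.
  move=> nu nv je; rewrite !eta'E // => He; rewrite inE (gain_subgraphE _ _ je) He /=.
  apply/existsPn=> z; apply/negP=> jz.
  by case: (joins_ends je jz) => [][eq1 eq2]; [rewrite eq2 eqxx in nv | rewrite eq1 eqxx in nu].
(* The gain is chosen so that switching by [eta'] turns it into 1. *)
have [e0 je0 eq0] := Kedge_exists (eta' w0 * (eta' w)^-1) nw0.
have unX : unlifted (e0 |: X).
  apply: unlifted_pendant je0 Xw; apply: unliftedS unH.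
  by apply/subsetP=> e; rewrite inE => /andP[].
have rX : rooted (e0 |: X) w0.
  apply/rootedP=> v _; have [->|nvw] := eqVneq v w.
    by apply/connect1/adjP; exists e0; rewrite ?setU11.
  have [-> //|nvw0] := eqVneq v w0; have nw0v : w0 != v by rewrite eq_sym.
  have [f jf eqf] := Kedge_exists (eta' w0 * (eta' v)^-1) nw0v.
  apply/connect1/adjP; exists f => //; apply/setU1r/(memX f w0 v) => //.
  by rewrite eqf mulKg mulVg group1.
have [H' [eta'' []]] := unlifted_closure unX rX.
have := @gain_subgraph_triangle_closed _ _ H' eta''.
move: (gain_subgraph H' eta'') => T closedT; rewrite subUset sub1set => /andP[Te0 sXT].
apply: unliftedS; apply/subsetP=> e; have [u [v je]] := Kedge_joins e.
have nuv := Kgraph_loopless je; rewrite (gain_subgraphE _ _ je) => He.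
apply: (@has_gain_mem _ _ T eta' e u v je); move: {e je} (_ * _ : gT) He => h Hh.
have hg0 : has_gain T eta' w0 w 1.
  by apply/has_gainP; exists e0; rewrite eq0 mulKg mulVg.
have hgX y z h' : y != w -> z != w -> y != z -> h' \in H -> has_gain T eta' y z h'.
  move=> nyw nzw nyz Hh'; have [f jf eqf] := Kedge_exists (eta' y * h' * (eta' z)^-1) nyz.
  have eqh : (eta' y)^-1 * psi f y z * eta' z = h' by rewrite eqf -!mulgA mulVg mulg1 mulKg.
  by apply/has_gainP; exists f; split=> //; apply/(subsetP sXT)/(memX f y z); rewrite ?eqh.
(* Go from [y] to [w0] with gain [h'], then along [e0]. *)
have hgW' y h' : y != w -> y != w0 -> h' \in H -> has_gain T eta' y w h'.
  by move=> nyw ny0 Hh'; rewrite -[h']mulg1; apply: (has_gainM closedT nyw (hgX y w0 h' _ _ _ _)).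
(* From [w0] itself, go with gain [h'] to a third vertex [z] and from there to [w] with gain 1. *)
have hgW y h' : y != w -> h' \in H -> has_gain T eta' y w h'.
  move=> nyw Hh'; have [eqy|] := eqVneq y w0; last by move=> ny0; apply: hgW'.
  have [z] := @fresh_vertex gT n n_ge4 [:: w; w0] isT.
  rewrite !inE negb_or => /andP[nzw nz0]; rewrite -[h']mulg1.
  apply: (has_gainM closedT nyw (hgX y z h' _ _ _ _) (hgW' z 1 _ _ _)) => //.
  by rewrite eqy eq_sym.
have [eqv|nvw] := eqVneq v w; first by rewrite eqv; apply: hgW; rewrite -?eqv.
have [equ|nuw] := eqVneq u w; last exact: hgX.
by rewrite equ -[h]invgK; apply/has_gainV/hgW; rewrite ?groupV.
Qed.

(** The values of [eta] are replaced by those of [eta'] one vertex at a time. *)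
Lemma unlifted_switch H eta eta' :
  unlifted (gain_subgraph H eta) -> unlifted (gain_subgraph H eta').
Proof.
move=> unH; have step (s : seq V) :
    unlifted (gain_subgraph H (fun v => if v \in s then eta' v else eta v)).
  elim: s => [//|w s IHs]; have := unlifted_switch1 w (eta' w) IHs.
  rewrite (@eq_gain_subgraph _ _ _ _ (fun v => if v \in w :: s then eta' v else eta v)) //.
  by move=> v; rewrite inE; case: eqVneq => [->|].
have := step (enum V); rewrite (@eq_gain_subgraph _ _ _ _ eta') // => v.
by rewrite mem_enum.
Qed.

(** * Unlifted subgroups *)

Definition unlifted_group H := unlifted (gain_subgraph H (fun=> 1)).

Lemma unlifted_groupE H eta : unlifted (gain_subgraph H eta) = unlifted_group H.
Proof. by apply/idP/idP; apply: unlifted_switch. Qed.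

(** Switching by the constant [g^-1] conjugates every gain. *)
Lemma unlifted_groupJ H g : unlifted_group H -> unlifted_group (H :^ g)%G.
Proof.
move/(@unlifted_switch _ _ (fun=> g^-1)); rewrite /unlifted_group.
suff -> : gain_subgraph H (fun=> g^-1) = gain_subgraph (H :^ g)%G (fun=> 1) :> {set E} by [].
apply/setP=> e; have [u [v je]] := Kedge_joins e.
by rewrite !(gain_subgraphE _ _ je) invg1 mul1g mulg1 mem_conjg /conjg mulgA.
Qed.

(* The [1]-labelled edges force the switching function of the closure to be
   constant modulo the group. *)
Lemma unlifted_identity X : unlifted X ->
    (forall e u v, joins e u v -> psi e u v = 1 -> e \in X) ->
  exists2 J, unlifted_group J & forall e u v, e \in X -> joins e u v -> psi e u v \in J.
Proof.
move=> unX X1; have [r _] := @fresh_vertex gT n n_ge4 [::] isT.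
have rX : rooted X r.
  apply/rootedP=> v _; have [-> //|nvr] := eqVneq v r; rewrite eq_sym in nvr.
  have [e je eqe] := Kedge_exists 1 nvr.
  by apply/connect1/adjP; exists e => //; apply: X1 je eqe.
have [H [eta [/subsetP sXH unH]]] := unlifted_closure unX rX.
exists (H :^ (eta r)^-1)%G; first by apply: unlifted_groupJ; rewrite -(unlifted_groupE _ eta).
have etaH v : (eta r)^-1 * eta v \in H.
  have [->|nvr] := eqVneq v r; first by rewrite mulVg.
  rewrite eq_sym in nvr; have [e je eqe] := Kedge_exists 1 nvr.
  by have := sXH e (X1 _ _ _ je eqe); rewrite (gain_subgraphE _ _ je) eqe mulg1.
move=> e u v /sXH + je; rewrite (gain_subgraphE _ _ je) => He.
have := groupM (groupM (etaH u) He) (groupVr (etaH v)).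
by rewrite mem_conjg invgK /conjg invMg invgK !mulgA !mulgK.
Qed.

(** Two disjoint digons, unbalanced modulo [G1] because [x] is outside [G1], form a loose handcuff
    with the edge [e]. It serves twice: each digon is independent in [N], and the two digons span
    [e]. *)
Lemma barbell_circuit x u u' v v' e1 f1 e2 f2 e :
    x \notin G1 -> uniq [:: u; u'; v; v'] ->
    joins e1 u u' -> psi e1 u u' = 1 -> joins f1 u u' -> psi f1 u u' = x ->
    joins e2 v v' -> psi e2 v v' = 1 -> joins f2 v v' -> psi f2 v v' = x ->
  joins e u v -> circuit N ([set e1; f1] :|: [set e2; f2] :|: [set e]).
Proof.
move=> G1x uniq4 je1 g1 jf1 gf1 je2 g2 jf2 gf2 je.
have digon e' f' w w' : joins e' w w' -> psi e' w w' = 1 -> joins f' w w' -> psi f' w w' = x ->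
    is_cycle [set e'; f'] /\ ~ balanced (quo_gain G1 psi) [set e'; f'].
  move=> je' ge' jf' gf'; have nef : e' != f'.
    by apply: contraNneq G1x => eqef; rewrite -gf' -eqef ge'.
  split; first exact: (digon_cycle (@Kgraph_loopless gT n) nef je' jf').
  move/(balanced_digon_gain (@Kgraph_loopless gT n) nef je' jf') => /=.
  rewrite /= in ge' gf'; rewrite ge' gf' morph1 => /esym x1.
  case/negP: G1x; apply: coset_idr x1.
  by rewrite (subsetP (normal_norm normalG1)) ?inE.
have [c1 nb1] := digon _ _ _ _ je1 g1 jf1 gf1.
have [c2 nb2] := digon _ _ _ _ je2 g2 jf2 gf2.
apply/frameN; apply: Or32; exists [set e1; f1], [set e2; f2]; split=> //; right.
rewrite /loose_handcuff (verts_digon je1 jf1) (verts_digon je2 jf2).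
move: uniq4; rewrite /= !inE !negb_or andbT.
case/and3P=> /and3P[nuu' nuv nuv'] /andP[nu'v nu'v'] nvv'.
have neqs := (negPf nuu', negPf nuv, negPf nuv', negPf nu'v, negPf nu'v', negPf nvv').
split=> //.
  rewrite disjoint_subset; apply/subsetP=> z; rewrite !inE => /orP[]/eqP->.
    by rewrite !neqs.
  by rewrite !neqs.
exists u, v, [:: (e, v)]; split.
- by rewrite /is_path /= je /walk_end /= eqxx inE nuv.
- apply/setP=> z; rewrite !inE; case: (eqVneq z u) => //= _; case: (eqVneq z v) => //= ->.
  by rewrite eq_sym neqs.
- apply/setP=> z; rewrite !inE; case: (eqVneq z v) => [->|_] //=; first by rewrite orbT.
  by case: (eqVneq z u) => //= ->; rewrite neqs.
by congr (_ :|: _); apply/setP=> z; rewrite !inE.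
Qed.

Lemma unlifted_group_cover a : a \notin G1 -> exists2 J, unlifted_group J & a \in J.
Proof.
move=> G1a; have [u _] := @fresh_vertex gT n n_ge4 [::] isT.
have [u'] := @fresh_vertex gT n n_ge4 [:: u] isT.
rewrite !inE eq_sym => nuu'.
have [v] := @fresh_vertex gT n n_ge4 [:: u; u'] isT.
rewrite !inE negb_or ![v == _]eq_sym => /andP[nuv nu'v].
have [v'] := @fresh_vertex gT n n_ge4 [:: u; u'; v] isT.
rewrite !inE !negb_or ![v' == _]eq_sym => /and3P[nuv' nu'v' nvv'].
have uniq4 : uniq [:: u; u'; v; v'].
  by rewrite /= !inE !negb_or nuu' nuv nuv' nu'v nu'v' nvv'.
have [e1 je1 g1] := Kedge_exists 1 nuu'; have [f1 jf1 gf1] := Kedge_exists a nuu'.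
have [e2 je2 g2] := Kedge_exists 1 nvv'; have [f2 jf2 gf2] := Kedge_exists a nvv'.
have [e je _] := Kedge_exists 1 nuv.
have cC := barbell_circuit G1a uniq4 je1 g1 jf1 gf1 je2 g2 jf2 gf2 je.
have indX : rank N [set e1; f1] = #|[set e1; f1]|.
  apply: circuit_proper cC _; apply/properP; split; first by rewrite -setUA subsetUl.
  exists e; first by rewrite !inE eqxx !orbT.
  apply/negP=> Xe; have := joins_verts Xe je; rewrite (verts_digon je1 jf1) !inE.
  by rewrite ![v == _]eq_sym (negPf nuv) (negPf nu'v) andbF.
have unX := unlifted_indep indX.
have rX : rooted [set e1; f1] u.
  apply/rootedP=> z; rewrite (verts_digon je1 jf1) => /set2P[->|->] //.
  by apply/connect1/adjP; exists e1; rewrite ?set21.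
have [H [eta [/subsetP sXH unH]]] := unlifted_closure unX rX.
(* The switched gains of [e1] and [f1] share the factor [eta u'] on the right, so their quotient
   [a ^ eta u] lies in [H]. *)
exists (H :^ (eta u)^-1)%G; first by apply: unlifted_groupJ; rewrite -(unlifted_groupE _ eta).
have := sXH _ (set21 _ _); rewrite (gain_subgraphE _ _ je1) g1 => H1.
have := sXH _ (set22 _ _); rewrite (gain_subgraphE _ _ jf1) gf1 => Ha.
have := groupM Ha (groupVr H1).
by rewrite mem_conjg invgK /conjg !invMg invgK invg1 mul1g !mulgA mulgK.
Qed.

(** The digon with gains 1 and [a] is balanced modulo [G1], hence a circuit of [N]. Being unlifted
    it is a circuit of [M], so it is balanced for the original gains as well. *)
Lemma unlifted_group_tiG1 J a : unlifted_group J -> a \in J -> a \in G1 -> a = 1.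
Proof.
move=> unJ Ja G1a; have [u _] := @fresh_vertex gT n n_ge4 [::] isT.
have [v] := @fresh_vertex gT n n_ge4 [:: u] isT; rewrite !inE eq_sym => nuv.
have [e je ge] := Kedge_exists 1 nuv; have [f jf gf] := Kedge_exists a nuv.
have [eqef|nef] := eqVneq e f; first by rewrite -gf -eqef.
have ll := @Kgraph_loopless gT n.
have cX : circuit N [set e; f].
  apply/frameN; apply: Or31; apply: (balanced_digon ll nef je jf) => /=.
  rewrite /= in ge gf; by rewrite ge gf morph1 coset_id.
have unX : unlifted [set e; f].
  apply: unliftedS unJ; apply/subsetP=> g /set2P[]->.
    by rewrite (gain_subgraphE _ _ je) ge !mulg1 invg1.
  by rewrite (gain_subgraphE _ _ jf) gf mulg1 invg1 mul1g.
have /cyclesM[/(_ ((unlifted_circuit cX).1 unX)) bal _] := digon_cycle ll nef je jf.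
by rewrite -gf -(balanced_digon_gain ll nef je jf bal).
Qed.

(** Barbells with one digon on each side span all edges across the split. An edge inside a side then
    closes a balanced triangle with two edges across. *)
Lemma split_spanning x u0 u1 X : x \notin G1 -> u0 != u1 ->
    (forall e u v, joins e u v -> (u \in [:: u0; u1]) = (v \in [:: u0; u1]) ->
       psi e u v = 1 \/ psi e u v = x -> e \in X) ->
  rank N X = rank N [set: E].
Proof.
move=> G1x n01 memX; set s := [:: u0; u1] in memX.
pose D : {set E} := [set e | [exists u, exists v, [&& u \in s, v \notin s & joins e u v]]].
have memD e u v : joins e u v -> u \in s -> v \notin s -> e \in D.
  by move=> je su sv; rewrite inE; apply/existsP; exists u; apply/existsP; exists v; rewrite su sv.
rewrite -(@rank_setU_absorb _ N X D); last first.
  move=> e; rewrite inE => /existsP[u /existsP[v /and3P[su sv je]]].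
  have [u' su' nuu'] : exists2 u', u' \in s & u != u'.
    move: su; rewrite !inE => /orP[]/eqP->.
      by exists u1; rewrite // !inE eqxx orbT.
    by exists u0; rewrite 1?eq_sym // !inE eqxx.
  (* As [s] has two elements, [4 <= n] leaves a second vertex for the digon at [v]. *)
  have [v'] := @fresh_vertex gT n n_ge4 (v :: s) isT.
  rewrite in_cons negb_or eq_sym => /andP[nvv' sv'].
  have neq y z : y \in s -> z \notin s -> y != z.
    by move=> sy; apply: contraNneq => <-.
  have uniq4 : uniq [:: u; u'; v; v'].
    by rewrite /= !inE !negb_or nuu' nvv' !neq.
  have [e1 je1 g1] := Kedge_exists 1 nuu'; have [f1 jf1 gf1] := Kedge_exists x nuu'.
  have [e2 je2 g2] := Kedge_exists 1 nvv'; have [f2 jf2 gf2] := Kedge_exists x nvv'.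
  have cC := barbell_circuit G1x uniq4 je1 g1 jf1 gf1 je2 g2 jf2 gf2 je.
  apply: circuit_span cC _ _; first by rewrite !inE eqxx !orbT.
  have eqs : (v \in s) = (v' \in s) by rewrite (negPf sv) (negPf sv').
  rewrite setUC setUS // !subUset !sub1set.
  rewrite (memX e1 u u') ?(memX f1 u u') ?(memX e2 v v') ?(memX f2 v v') ?su ?su' //;
    by [left | right].
rewrite -(setUT (X :|: D)); apply/esym/rank_setU_absorb => e _.
have [u [v je]] := Kedge_joins e; have nuv := Kgraph_loopless je.
have memDC f y z : joins f y z -> y \notin s -> z \in s -> f \in D.
  by rewrite joinsC => jf sy sz; apply: memD jf sz sy.
have inXD : e \in D -> rank N (e |: (X :|: D)) = rank N (X :|: D).
  by move=> De; rewrite (setUidPr _) // sub1set inE De orbT.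
(* The apex [w] will be taken on the other side. The gains [psi e u v] and 1 balance the triangle,
   and [D] contains the edges across of every gain. *)
have via w : u != w -> w != v -> (forall f, joins f u w -> f \in D) ->
    (forall f, joins f w v -> f \in D) -> rank N (e |: (X :|: D)) = rank N (X :|: D).
  move=> nuw nwv Duw Dwv; have [f jf gf] := Kedge_exists (psi e u v) nuw.
  have [g jg gg] := Kedge_exists 1 nwv.
  apply: (@circuit_span _ N [set f; g; e]); first last.
  - apply/subsetP=> h; rewrite 2!in_setU => /orP[/orP[]|] /set1P->.
    + by rewrite !in_setU Duw // !orbT.
    + by rewrite !in_setU Dwv // !orbT.
    by rewrite in_setU set11.
  - by rewrite !inE eqxx orbT.
  apply/frameN; apply: Or31; apply: (balanced_triangle (u := u) (v := w) (w := v)) => //.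
    by rewrite /= !inE negb_or nuw nuv nwv.
  by rewrite /= in gf gg *; rewrite gf gg morph1 mulg1.
have neq y z : (y \in s) != (z \in s) -> y != z by apply: contraNneq => ->.
have [su|su] := boolP (u \in s); have [sv|sv] := boolP (v \in s).
- have [w sw] := @fresh_vertex gT n n_ge4 s isT.
  by apply: (via w) => [||f jf|f jf]; [apply: neq | apply: neq | apply: memD jf _ _ |
    apply: memDC jf _ _]; rewrite ?su ?sv ?(negPf sw).
- by apply: inXD; apply: memD je su sv.
- by apply: inXD; apply: memDC je su sv.
have su0 : u0 \in s by rewrite mem_head.
by apply: (via u0) => [||f jf|f jf]; [apply: neq | apply: neq | apply: memDC jf _ _ |
  apply: memD jf _ _]; rewrite ?su0 ?(negPf su) ?(negPf sv).
Qed.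

(* On the two sides of the split, switching by [1] and by [g] keeps the gain [x]
   inside [B'], so the two subgraphs share an [N]-spanning set: they form a
   modular pair and their union is unlifted. *)
Lemma unlifted_group_merge B B' g x : unlifted_group B -> unlifted_group B' ->
    x \in B -> x \in B' -> x ^ g \in B' -> x != 1 ->
  exists J, [/\ unlifted_group J, B \subset J, B' \subset J & g \in J].
Proof.
move=> unB unB' Bx B'x B'xg nx1.
have G1x : x \notin G1.
  by apply: contra nx1 => G1x; apply/eqP; apply: unlifted_group_tiG1 unB Bx G1x.
have [u0 _] := @fresh_vertex gT n n_ge4 [::] isT.
have [u1] := @fresh_vertex gT n n_ge4 [:: u0] isT; rewrite inE eq_sym => n01.
pose s := [:: u0; u1]; pose eta (v : V) := if v \in s then 1 else g.
pose X := gain_subgraph B (fun=> 1) : {set E}; pose Y := gain_subgraph B' eta : {set E}.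
have unY : unlifted Y by rewrite /Y unlifted_groupE.
have spanXY : rank N (X :&: Y) = rank N [set: E].
  apply: split_spanning G1x n01 _ => e u v je eqs gxe.
  apply/setIP; rewrite !(gain_subgraphE _ _ je) /eta -eqs invg1 mul1g mulg1.
  split; first by case: gxe => ->.
  case: ifP => _; first by rewrite invg1 mul1g mulg1; case: gxe => ->.
  by rewrite -mulgA; case: gxe => ->; rewrite // mul1g mulVg.
have [|J unJ JXY] := unlifted_identity (unlifted_setU (unB : unlifted X) unY spanXY).
  by move=> e u v je ge; rewrite inE (gain_subgraphE _ _ je) ge !mulg1 invg1 group1.
have s0 : u0 \in s by rewrite mem_head.
have s1 : u1 \in s by rewrite inE mem_head orbT.
exists J; split=> //.
(* Both subgroups are read off the edges between [u0] and [u1], where [eta] is 1. *)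
- apply/subsetP=> b Bb; have [e je ge] := Kedge_exists b n01.
  rewrite -ge; apply: (JXY _ _ _ _ je); rewrite inE (gain_subgraphE _ _ je) ge.
  by rewrite invg1 mul1g mulg1 Bb.
- apply/subsetP=> b Bb; have [e je ge] := Kedge_exists b n01.
  rewrite -ge; apply: (JXY _ _ _ _ je); rewrite inE !(gain_subgraphE _ _ je) ge /eta s0 s1.
  by rewrite invg1 mul1g mulg1 Bb orbT.
have [w sw] := @fresh_vertex gT n n_ge4 s isT.
have n0w : u0 != w by apply: contraNneq sw => <-.
(* An edge across the split with gain [g^-1] has gain 1 after switching by [eta], so it lies in
   [Y]. *)
have [e je ge] := Kedge_exists g^-1 n0w; rewrite -groupV -ge; apply: (JXY _ _ _ _ je).
by rewrite inE !(gain_subgraphE _ _ je) ge /eta s0 (negPf sw) invg1 mul1g mulVg group1 orbT.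
Qed.

(** * The family of maximal unlifted subgroups *)

Definition max_unlifted_groups : {set {group gT}} :=
  [set B : {group gT} | maxgroup B unlifted_group].

Local Notation A := max_unlifted_groups.

Lemma max_unlifted_groups_cover H : unlifted_group H -> exists2 B, B \in A & H \subset B.
Proof.
move=> unH; have [B maxB sHB] := @maxgroup_exists gT unlifted_group H unH.
by exists B; rewrite ?inE.
Qed.

Lemma max_unlifted_groups_partition : subgroup_partition (G1 |: A).
Proof.
move=> x nx1; have tiG1 B : B \in A -> x \in B -> x \notin G1.
  rewrite inE => /maxgroupP[unB _] Bx; apply: contra nx1 => G1x.
  by apply/eqP; apply: unlifted_group_tiG1 unB Bx G1x.
have [G1x|G1x] := boolP (x \in G1).
  exists G1; split=> [|B [/setU1P[->//|AB] Bx]]; first by rewrite setU11.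
  by have := tiG1 B AB Bx; rewrite G1x.
have [J unJ Jx] := unlifted_group_cover G1x.
have [B AB /subsetP/(_ x Jx) Bx] := max_unlifted_groups_cover unJ.
exists B; split=> [|B' [/setU1P[eqB'|AB'] B'x]]; first by rewrite setU1r.
  by rewrite eqB' (negPf G1x) in B'x.
move: AB AB'; rewrite !inE => /maxgroupP[unB maxB] /maxgroupP[unB' maxB'].
have [|K [unK sBK sB'K _]] := @unlifted_group_merge B B' 1 x unB unB' Bx B'x _ nx1.
  by rewrite conjg1.
by apply/val_inj; rewrite /= -(maxB K unK sBK) (maxB' K unK sB'K).
Qed.

Lemma max_unlifted_groups_malnormal B : B \in A -> malnormal B.
Proof.
rewrite inE => /maxgroupP[unB maxB] g Bg; apply/setP=> y; rewrite !inE.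
apply/andP/eqP => [[Byg By]|->]; last by rewrite !group1.
apply/eqP/negPn/negP=> ny1; case/negP: Bg.
(* Merging applies to [y ^ g^-1]: this element and its conjugate [y] by [g] both lie in [B]. *)
have Bx : y ^ g^-1 \in B by rewrite -mem_conjg.
have [||J [unJ sBJ _ Jg]] := @unlifted_group_merge B B g (y ^ g^-1) unB unB Bx Bx.
- by rewrite conjgKV.
- by rewrite conjg_eq1.
by rewrite -(maxB J unJ sBJ).
Qed.

Lemma max_unlifted_groupsJ B g : B \in A -> (B :^ g)%G \in A.
Proof.
rewrite !inE => /maxgroupP[unB maxB]; apply/maxgroupP; split=> [|J unJ sBJ].
  exact: unlifted_groupJ.
have := maxB _ (unlifted_groupJ g^-1 unJ); rewrite /= -sub_conjg => /(_ sBJ) <-.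
by rewrite conjsgKV.
Qed.

(** Handcuffs and thetas are connected, so an unlifted one lies in a closure, whose subgroup extends
    to a maximal one. Balanced cycles are settled by the assumption on the cycles that are circuits
    of [M]. *)
Lemma circuit_unliftedP C : circuit N C -> (unlifted C <-> lift_circuit A psi N C).
Proof.
move=> cC; split=> [unC|[_ [bal|[_ [eta [B]]]]]].
- split=> //; have rootedC r : rooted C r -> exists eta, exists2 B : {group gT},
      B \in A & gain_set (switch psi eta) C \subset B.
    move=> rC; have [H [eta [sCH unH]]] := unlifted_closure unC rC.
    rewrite unlifted_groupE in unH; have [B AB sHB] := max_unlifted_groups_cover unH.
    exists eta, B => //; apply: subset_trans sHB; by rewrite -sub_gain_subgraph.
  have /frameN[bal|[C1 [C2 [hC _ _]]]|[P1 [P2 [P3 [tC _ _ _]]]]] := cC.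
  + left; have cycC := balanced_cycle bal.
    by apply/(cyclesM cycC)/(unlifted_circuit cC).
  + by right; split; [left; exists C1, C2 | have [r /rootedC] := handcuff_rooted hC].
  by right; split; [right; exists P1, P2, P3 | have [r /rootedC] := theta_rooted tC].
- by apply/(unlifted_circuit cC)/(cyclesM (balanced_cycle bal)).
rewrite inE => /maxgroupP[unB _]; rewrite -sub_gain_subgraph => sCB.
by apply: unliftedS sCB _; rewrite unlifted_groupE.
Qed.

(** A set is unlifted exactly when all [N]-circuits inside it are: one direction is monotonicity,
    the other [lift_rank_eqP]. *)
Lemma max_unlifted_groups_gain_lift : is_gain_lift G1 A psi M.
Proof.
exists N => // X all_lift; split=> [lX|nlX].
  apply: (lift_rank_eqP liftMN) => C cC sCX.
  exact/eqP/(circuit_unliftedP cC)/lX.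
have /andP[leNM leMN] := lift_rank_bounds liftMN X.
apply/eqP; rewrite eqn_leq leMN ltn_neqAle leNM andbT; apply/negP=> /eqP eqX.
by apply: nlX => C cC sCX; apply/(circuit_unliftedP cC)/(unliftedS sCX)/eqP.
Qed.

End Lift.

Theorem theorem1p2 (gT : finGroupType) (G1 : {group gT})
    (hG1 : (G1 <| [set: gT])%g) (n : nat) (hn : 4 <= n)
    (N M : matroid (edge (Kgraph gT n)))
    (hN : is_frame_matroid (quo_gain G1 (Kgain gT n)) N)
    (hM : elementary_lift M N)
    (hcyc : forall C : {set edge (Kgraph gT n)}, is_cycle C ->
       (circuit M C <-> balanced (Kgain gT n) C)) :
  exists A : {set {group gT}},
    [/\ subgroup_partition (G1 |: A),
        forall B : {group gT}, B \in A -> malnormal B,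
        forall (B : {group gT}) (g : gT), B \in A -> (B :^ g)%G \in A &
        is_gain_lift G1 A (Kgain gT n) M].
Proof.
exists (max_unlifted_groups N M); split.
- exact: max_unlifted_groups_partition hG1 hn hN hM hcyc.
- exact: max_unlifted_groups_malnormal hG1 hn hN hM hcyc.
- exact: max_unlifted_groupsJ hG1 hn hN hM hcyc.
exact: max_unlifted_groups_gain_lift hG1 hn hN hM hcyc.
Qed.
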